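(* Let $G\sim\mathcal{G}_{p,q,k}$ have $k$ hidden clusters each of size $m$, where $k=o(m^{\lambda})$ for every fixed $\lambda>0$, and let $p=\frac{\alpha\log m}{m}$, $q=\frac{\beta\log m}{m}$ with $\alpha>\beta>0$ fixed constants. If $\sqrt{\alpha}-\sqrt{\beta}<1$, then it is information-theoretically impossible to recover the hidden clusters exactly with high probability; that is, no procedure taking $G$ as input outputs the hidden partition with probability tending to $1$.
   Context: The stochastic block model $\mathcal{G}_{p,q,k}$: the vertex set $V=[n]$, $n=km$, is partitioned into $k$ hidden clusters $P_1,\dots,P_k$ each of size $m=n/k$; a random graph $G$ on $V$ is formed by including each pair of vertices in the same cluster as an edge independently with probability $p$ and each pair in different clusters independently with probability $q$, where $p>q$. Logarithms are natural; asymptotics are as $m\to\infty$. *)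

(* Defs.v *)
From mathcomp Require Import all_boot all_order all_algebra.
From mathcomp Require Import reals.
Import Order.TTheory GRing.Theory Num.Theory.

Set Implicit Arguments.
Unset Strict Implicit.
Unset Printing Implicit Defensive.

Local Open Scope ring_scope.

Section StochasticBlockModel.
Variables (R : realType) (T : finType).

Definition vertex_pairs : {set {set T}} := [set e : {set T} | #|e| == 2%N].

(* A simple graph on T is identified with its edge set E \subset vertex_pairs,
   so that graphs is the set of all simple graphs on T. *)
Definition graphs : {set {set {set T}}} := powerset vertex_pairs.

Definition cluster_partitions (k m : nat) : {set {set {set T}}} :=
  [set P : {set {set T}} | [&& partition P [set: T], #|P| == k
                             & [forall B in P, #|B| == m]]].

Definition same_cluster (P : {set {set T}}) (e : {set T}) : bool :=
  [exists B in P, e \subset B].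

Definition edge_prob (p q : R) (P : {set {set T}}) (e : {set T}) : R :=
  if same_cluster P e then p else q.

(* This is a probability mass function on graphs only when p and q lie in
   [0, 1]. With p = alpha * ln m / m this may fail for finitely many m, which
   does not affect limits as m tends to infinity. *)
Definition sbm_prob (p q : R) (P E : {set {set T}}) : R :=
  \prod_(e in vertex_pairs)
    (if e \in E then edge_prob p q P e else 1 - edge_prob p q P e).

(* A procedure may use internal randomness: A E Q is the probability that it
   outputs Q on input the graph E. A deterministic procedure f is the case
   A E Q = (f E == Q)%:R. *)
Definition is_procedure (A : {set {set T}} -> {set {set T}} -> R) : Prop :=
  forall E, (forall Q, 0 <= A E Q) /\ \sum_Q A E Q = 1.

Definition success_prob (p q : R) (P : {set {set T}})
    (A : {set {set T}} -> {set {set T}} -> R) : R :=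
  \sum_(E in graphs) sbm_prob p q P E * A E P.

(* The hidden partition is uniform among the partitions into k clusters of
   size m. The minimum of success_prob over these partitions is at most this
   average, so impossibility for the average implies worst-case
   impossibility. *)
Definition recovery_prob (k m : nat) (p q : R)
    (A : {set {set T}} -> {set {set T}} -> R) : R :=
  (#|cluster_partitions k m|%:R)^-1 *
    \sum_(P in cluster_partitions k m) success_prob p q P A.

End StochasticBlockModel.

(* Main.v *)
Require Import Defs.
From mathcomp Require Import all_boot all_order all_algebra.
From mathcomp Require Import fingroup perm zify ring lra.
From mathcomp Require Import reals sequences exp.
Import Order.TTheory GRing.Theory Num.Theory.

(* Let u and v lie in different clusters B and C of the hidden partition P. If u
   has more neighbours in C than in B, and v more in B than in C, then swapping
   u and v yields a partition under which the observed graph is at least as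
   likely, so that no procedure can prefer P. For a single vertex u of B this
   imbalance has probability m ^ (- (sqrt alpha - sqrt beta) ^ 2 + o(1)), hence
   the expected number of such u tends to infinity when the gap is below 1. Two
   vertices of B interact only through the edge joining them, so the second
   moment method shows that such u and v both exist with probability bounded
   away from 0. *)

Set Implicit Arguments.
Unset Strict Implicit.
Unset Printing Implicit Defensive.

Local Open Scope ring_scope.

(** * Random subsets with independent elements *)

Section BernoulliSets.
Variables (R : realFieldType) (X : finType) (w : X -> R).

Definition bern (E : {set X}) : R := \prod_e (if e \in E then w e else 1 - w e).

Definition expect (F : {set X} -> R) : R := \sum_E bern E * F E.

Definition prob (a : pred {set X}) : R := expect (fun E => (a E)%:R).

(** Expanding the product of two-term sums chooses one summand for each [e], that is, one set
    [E]. *)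
Lemma expect_prod (f g : X -> R) :
  expect (fun E => \prod_e (if e \in E then f e else g e)) =
  \prod_e (w e * f e + (1 - w e) * g e).
Proof.
rewrite (bigA_distr 1 (GRing.add)) /expect; apply: eq_bigr => E _.
by rewrite -big_split /=; apply: eq_bigr => e _; case: ifP.
Qed.

Lemma expect_const (c : R) : expect (fun=> c) = c.
Proof.
rewrite -[RHS]mul1r /expect -mulr_suml; congr (_ * c).
have := expect_prod (fun=> 1) (fun=> 1).
rewrite [RHS]big1 => [<-|e _]; last by lra.
apply: eq_bigr => E _; rewrite big1 ?mulr1 // => e _; by case: ifP.
Qed.

Lemma eq_expect (F G : {set X} -> R) : F =1 G -> expect F = expect G.
Proof. by move=> FG; apply: eq_bigr => E _; rewrite FG. Qed.

Definition merge (S A B : {set X}) : {set X} := (A :&: S) :|: (B :\: S).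

(* Resampling an independent copy off S, via the involution of pairs
   (A, B) |-> (merge S A B, merge S B A), which preserves the product law. *)
Lemma expect_merge (S : {set X}) (F : {set X} -> R) :
  expect F = expect (fun A => expect (fun B => F (merge S A B))).
Proof.
pose swap (u : {set X} * {set X}) := (merge S u.1 u.2, merge S u.2 u.1).
have swapK : involutive swap.
  move=> [A B]; congr (_, _); apply/setP => e; rewrite !inE /=;
  by case: (e \in A); case: (e \in B); case: (e \in S).
have bern_swap u : bern (swap u).1 * bern (swap u).2 = bern u.1 * bern u.2.
  rewrite -!big_split /=; apply: eq_bigr => e _; rewrite !inE.
  case: (e \in S); rewrite ?andbT ?andbF ?orbF //=.
  by rewrite mulrC.
transitivity (\sum_u bern u.1 * bern u.2 * F u.1).
  rewrite -(pair_big predT predT (fun A B => bern A * bern B * F A)) /=.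
  apply: eq_bigr => A _; rewrite -[F A in LHS]expect_const /expect mulr_sumr.
  by apply: eq_bigr => B _; rewrite mulrA.
rewrite (reindex_inj (inv_inj swapK)) /=.
transitivity (\sum_u bern u.1 * bern u.2 * F (merge S u.1 u.2)).
  by apply: eq_bigr => u _; rewrite -bern_swap.
rewrite -(pair_big predT predT
  (fun A B => bern A * bern B * F (merge S A B))) /=.
apply: eq_bigr => A _; rewrite /expect mulr_sumr.
by apply: eq_bigr => B _; rewrite mulrA.
Qed.

(** Measurability with respect to the elements of [S]. *)
Definition depends_on (Y : Type) (S : {set X}) (F : {set X} -> Y) :=
  forall E, F (E :&: S) = F E.

(** After resampling off [S], [F] sees only the first copy, and [G] only the second because [T]
    avoids [S]. *)
Lemma expect_indep (S T : {set X}) (F G : {set X} -> R) :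
  depends_on S F -> depends_on T G -> [disjoint S & T] ->
  expect (fun E => F E * G E) = expect F * expect G.
Proof.
move=> dF dG dST; rewrite (expect_merge S) /expect mulr_suml.
apply: eq_bigr => A _; rewrite !mulr_sumr; apply: eq_bigr => B _.
have -> : F (merge S A B) = F A.
  rewrite -(dF (merge S A B)) -(dF A); congr F; apply/setP => e; rewrite !inE.
  by case: (e \in S); rewrite ?andbT ?andbF ?orbF.
have -> : G (merge S A B) = G B.
  rewrite -(dG (merge S A B)) -(dG B); congr G; apply/setP => e; rewrite !inE.
  case eT: (e \in T); rewrite ?andbF // (disjointFl dST eT).
  by rewrite andbF.
by ring.
Qed.

Lemma prob_indep (S T : {set X}) (a b : pred {set X}) :
  depends_on S a -> depends_on T b -> [disjoint S & T] ->
  prob (predI a b) = prob a * prob b.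
Proof.
move=> da db dST; rewrite -(@expect_indep S T) //.
- by apply: eq_expect => E /=; rewrite -natrM mulnb.
- by move=> E /=; rewrite da.
- by move=> E /=; rewrite db.
Qed.

(** The indicator of the trace is a product of one condition per element, trivial outside [S], so
    [expect_prod] applies. *)
Lemma prob_trace (S J : {set X}) : J \subset S ->
  prob (fun E => E :&: S == J) =
  \prod_(e in S) (if e \in J then w e else 1 - w e).
Proof.
move=> JS; transitivity (expect (fun E => \prod_e
  (if e \in E then ((e \in S) ==> (e \in J))%:R
              else ((e \in S) ==> (e \notin J))%:R))).
  apply: eq_expect => E; case: eqP => [<-|neq].
    rewrite big1 // => e _; rewrite !inE; case: (e \in S) => //=.
      by case: (e \in E).
    by case: ifP.
  suff /exists_inP[e eS neq_e] : [exists e in S, (e \in E) != (e \in J)].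
    rewrite (bigD1 e) //= eS /=; move: neq_e.
    by case: (e \in E); case: (e \in J) => //=; rewrite mul0r.
  apply: contra_notT neq => /exists_inPn eqS; apply/setP => e; rewrite !inE.
  case eS: (e \in S); first by have /negPn/eqP-> := eqS e eS; rewrite andbT.
  by rewrite andbF; apply/esym/negbTE; apply: contraFN eS => /(subsetP JS).
rewrite expect_prod [RHS]big_mkcond /=; apply: eq_bigr => e _.
case: (e \in S) => /=; last by lra.
by case: (e \in J) => /=; lra.
Qed.

(** The binomial law, by summing over the possible traces of size [j], which are equally likely. *)
Lemma prob_card (S : {set X}) (c : R) (j : nat) :
  {in S, forall e, w e = c} -> (j <= #|S|)%N ->
  prob (fun E => #|E :&: S| == j) =
  'C(#|S|, j)%:R * (c ^+ j * (1 - c) ^+ (#|S| - j)).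
Proof.
move=> wc jS.
transitivity
  (\sum_(J in [set J : {set X} | J \subset S & #|J| == j])
     prob (fun E => E :&: S == J)).
  rewrite exchange_big /=; apply: eq_bigr => E _; rewrite -mulr_sumr.
  congr (_ * _); case: (boolP (_ == j)) => Ej.
    rewrite (bigD1 (E :&: S)) ?inE ?subsetIr //= eqxx big1 ?addr0 //.
    by move=> J /andP[_ /negPf]; rewrite eq_sym => ->.
  rewrite big1 // => J; rewrite inE => /andP[_ /eqP Jj].
  by case: eqP => // EJ; rewrite EJ Jj eqxx in Ej.
rewrite -cards_draws -sum1_card natr_sum mulr_suml; apply: eq_bigr => J.
rewrite inE mul1r => /andP[JS /eqP Jj]; rewrite prob_trace //.
rewrite (bigID (mem J)) /=; congr (_ * _).
  rewrite (eq_bigr (fun=> c)) => [|e /andP[/wc-> ->] //].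
  rewrite prodr_const -Jj; congr (_ ^+ _); apply: eq_card => e.
  by rewrite unfold_in /=; apply: andb_idl => /(subsetP JS).
rewrite (eq_bigr (fun=> 1 - c)) => [|e /andP[/wc-> /negPf-> ] //].
rewrite prodr_const -Jj; congr (_ ^+ _).
rewrite -(cardsID J S) (setIidPr JS) addKn; apply: eq_card => e.
by rewrite unfold_in /= !inE andbC.
Qed.

(** * Inequalities for weights in the unit interval *)

Hypothesis w01 : forall e, 0 <= w e <= 1.

Lemma bern_ge0 E : 0 <= bern E.
Proof. by apply: prodr_ge0 => e _; have := w01 e; case: ifP => _; lra. Qed.

Lemma ler_expect (F G : {set X} -> R) :
  (forall E, F E <= G E) -> expect F <= expect G.
Proof. by move=> FG; apply: ler_sum => E _; rewrite ler_wpM2l ?bern_ge0. Qed.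

Lemma ler_prob (a b : pred {set X}) : subpred a b -> prob a <= prob b.
Proof.
move=> ab; apply: ler_expect => E; rewrite ler_nat.
by case aE: (a E) => //; rewrite (ab E aE).
Qed.

Lemma prob_ge0 (a : pred {set X}) : 0 <= prob a.
Proof. by apply: sumr_ge0 => E _; rewrite mulr_ge0 ?bern_ge0. Qed.

Lemma probI_ge (a b : pred {set X}) : prob a + prob b - 1 <= prob (predI a b).
Proof.
rewrite lerBlDr -[1 in leRHS](expect_const 1) -!big_split /=.
apply: ler_sum => E _; rewrite -!mulrDr ler_wpM2l ?bern_ge0 //=.
by case: (a E); case: (b E) => /=; lra.
Qed.

(* The test functional [2 t N - t ^ 2 N ^ 2] of the number N of occurring
   events is below the indicator of [N > 0]; take [t = 1 / mu]. *)
Lemma prob_exists_ge (I : finType) (U : {set I}) (a : I -> pred {set X})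
    (K mu : R) :
  0 < mu -> mu = \sum_(i in U) prob (a i) -> 0 <= K ->
  {in U &, forall i j, i != j ->
     prob (predI (a i) (a j)) <= K * (prob (a i) * prob (a j))} ->
  2 - mu^-1 - K <= prob (fun E => [exists i in U, a i E]).
Proof.
move=> mu0 muE K0 corr; pose N E : R := \sum_(i in U) (a i E)%:R.
have EN : expect N = mu.
  rewrite muE exchange_big /=; apply: eq_bigr => E _.
  by rewrite /N mulr_sumr.
have EN2 : expect (fun E => N E ^+ 2) <= mu + K * mu ^+ 2.
  have -> : expect (fun E => N E ^+ 2) =
            \sum_(i in U) \sum_(j in U) prob (predI (a i) (a j)).
    under [RHS]eq_bigr do rewrite exchange_big /=.
    rewrite exchange_big /=; apply: eq_bigr => E _.
    rewrite expr2 /N mulr_suml mulr_sumr; apply: eq_bigr => i _.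
    rewrite !mulr_sumr; apply: eq_bigr => j _.
    by rewrite -natrM mulnb.
  rewrite expr2 {1 2}muE mulr_suml mulr_sumr -big_split /=.
  (* The diagonal terms sum to at most [mu]; [corr] bounds the others, and the diagonal part of
     [K * mu ^+ 2] is nonnegative. *)
  apply: ler_sum => i iU; rewrite (bigD1 i) //=; apply: lerD.
    by apply: ler_prob => E /= /andP[].
  rewrite muE !mulr_sumr [leRHS](bigD1 i) //= -[leLHS]add0r lerD //.
    by rewrite !mulr_ge0 ?prob_ge0.
  by apply: ler_sum => j /andP[jU ji]; rewrite corr // eq_sym.
have test E : 2 * mu^-1 * N E - mu^-1 ^+ 2 * N E ^+ 2 <=
              ([exists i in U, a i E])%:R.
  case: (boolP [exists i in U, _]) => [_|/exists_inPn none].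
    rewrite -subr_ge0 [leRHS](_ : _ = (1 - mu^-1 * N E) ^+ 2) ?sqr_ge0 //=.
    by ring.
  by rewrite /N big1 ?expr0n /= ?mulr0 ?subr0 // => i /none/negPf->.
apply: le_trans (ler_expect test).
have -> : expect (fun E => 2 * mu^-1 * N E - mu^-1 ^+ 2 * N E ^+ 2) =
  2 * mu^-1 * expect N - mu^-1 ^+ 2 * expect (fun E => N E ^+ 2).
  rewrite /expect !mulr_sumr -sumrB; apply: eq_bigr => E _; ring.
rewrite EN; have muV : mu^-1 * mu = 1 by rewrite mulVf ?gt_eqF.
have : mu^-1 ^+ 2 * expect (fun E => N E ^+ 2) <=
       mu^-1 ^+ 2 * (mu + K * mu ^+ 2) by rewrite ler_wpM2l ?sqr_ge0.
have -> : mu^-1 ^+ 2 * (mu + K * mu ^+ 2) =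
  mu^-1 * (mu^-1 * mu) + K * (mu^-1 * mu) ^+ 2 by ring.
rewrite -mulrA muV; lra.
Qed.

Definition fewer (S T : {set X}) : pred {set X} :=
  fun E => (#|E :&: S| < #|E :&: T|)%N.

Lemma depends_on_fewer S T : depends_on (S :|: T) (fewer S T).
Proof.
move=> E; rewrite /fewer -!setIA.
by rewrite (setIidPr (subsetUl S T)) (setIidPr (subsetUr S T)).
Qed.

(* Deleting the shared element f from S and S' only makes the events likelier
   and makes them independent. *)
Lemma prob_ltn_corr (S T S' T' : {set X}) (f : X) (c : R) :
  w f = c -> c < 1 ->
  [disjoint (S :\ f) :|: T & (S' :\ f) :|: T'] ->
  f \notin T -> f \notin T' ->
  prob (predI (fewer S T) (fewer S' T')) <=
  (1 - c) ^- 2 * (prob (fewer S T) * prob (fewer S' T')).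
Proof.
move=> wf c1 disj fT fT'.
(* The absence of [f] has probability [1 - c] and is independent of [fewer (A :\ f) B]; on this
   event [A] and [A :\ f] have the same trace. *)
have drop (A B : {set X}) : f \notin B ->
  (1 - c) * prob (fewer (A :\ f) B) <=
  prob (fewer A B).
  move=> fB; have <- : prob (fun E => E :&: [set f] == set0) = 1 - c.
    by rewrite prob_trace ?sub0set // big_set1 inE wf.
  rewrite -(@prob_indep [set f] ((A :\ f) :|: B)).
  - apply: ler_prob => E /= /andP[/eqP Ef].
    congr (_ < _)%N; apply: eq_card => e; rewrite !inE.
    case: eqP => [->|//] /=; rewrite andbF; apply/esym/negbTE.
    apply/negP => /andP[fE _]; have : f \in E :&: [set f] by rewrite !inE fE /=.
    by rewrite Ef inE.
  - by move=> E; rewrite -setIA setIid.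
  - exact: depends_on_fewer.
  - rewrite disjoints1 !inE eqxx /=; exact: fB.
set a := fewer S T; set b := fewer S' T'.
pose a' := fewer (S :\ f) T; pose b' := fewer (S' :\ f) T'.
have ab' : prob (predI a b) <= prob a' * prob b'.
  rewrite -(@prob_indep ((S :\ f) :|: T) ((S' :\ f) :|: T')) //.
  - have sub A E : (#|E :&: (A :\ f)| <= #|E :&: A|)%N.
      by rewrite subset_leq_card // setIS // subsetDl.
    apply: ler_prob => E /= /andP[aE bE].
    by apply/andP; split; apply: leq_ltn_trans (sub _ _) _.
  - exact: depends_on_fewer.
  - exact: depends_on_fewer.
have ha : (1 - c) * prob a' <= prob a := drop S T fT.
have hb : (1 - c) * prob b' <= prob b := drop S' T' fT'.
have c0 : 0 < 1 - c by lra.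
apply: le_trans ab' _; rewrite ler_pdivlMl ?exprn_gt0 //.
have -> : (1 - c) ^+ 2 * (prob a' * prob b') =
  ((1 - c) * prob a') * ((1 - c) * prob b') by ring.
by rewrite ler_pM // mulr_ge0 ?prob_ge0 // ltW.
Qed.

(** Only the outcomes with exactly [j] elements in [S] and [j.+1] in [T] are kept. The sizes differ
    by one because a vertex has [n] possible neighbours in its own cluster and [n.+1] in another. *)
Lemma prob_ltn_ge (S T : {set X}) (p q : R) (n j : nat) :
  {in S, forall e, w e = p} -> {in T, forall e, w e = q} ->
  [disjoint S & T] -> #|S| = n -> #|T| = n.+1 -> (j <= n)%N ->
  'C(n, j)%:R * (p ^+ j * (1 - p) ^+ (n - j)) *
  ('C(n.+1, j.+1)%:R * (q ^+ j.+1 * (1 - q) ^+ (n - j))) <=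
  prob (fewer S T).
Proof.
move=> wS wT dST cS cT jn.
have := prob_card wS; have := prob_card wT; rewrite cS cT => hT hS.
rewrite -hS // -subSS -hT // -(@prob_indep S T) //.
- by apply: ler_prob => E /andP[/eqP SE /eqP TE]; rewrite /fewer SE TE.
- by move=> E; rewrite -setIA setIid.
- by move=> E; rewrite -setIA setIid.
Qed.

End BernoulliSets.

(** * Swapping two vertices *)

Section Clusters.
Variable T : finType.
Implicit Types (P E : {set {set T}}) (B C : {set T}).

Definition star (u : T) (S : {set T}) : {set {set T}} :=
  [set [set u; x] | x in S].

Lemma set2_injr (u x y : T) : [set u; x] = [set u; y] -> x = y.
Proof.
move=> eq_uxy; have : x \in [set u; y] by rewrite -eq_uxy !inE eqxx orbT.
have : y \in [set u; x] by rewrite eq_uxy !inE eqxx orbT.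
by rewrite !inE => /orP[/eqP->|/eqP->] // /orP[]/eqP->.
Qed.

Lemma mem_star u (S : {set T}) x : x \in S -> [set u; x] \in star u S.
Proof. exact: imset_f. Qed.

Lemma card_star u S : #|star u S| = #|S|.
Proof. by rewrite card_imset // => x y; exact: set2_injr. Qed.

Lemma same_cluster_pair P x y : partition P [set: T] ->
  same_cluster P [set x; y] = (pblock P x == pblock P y).
Proof.
case/and3P=> /eqP covP tiP _; have xP z : z \in cover P by rewrite covP inE.
rewrite eq_pblock //; apply/exists_inP/idP => [[B BP]|xy].
  by rewrite subUset !sub1set => /andP[xB yB]; rewrite (def_pblock tiP BP xB).
by exists (pblock P x); rewrite ?pblock_mem // subUset !sub1set mem_pblock xP.
Qed.

Definition in_pairs P : {set {set T}} :=
  [set e in vertex_pairs T | same_cluster P e].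

Lemma sbm_prob_card (R : realType) (p q : R) P E : E \in graphs T ->
  sbm_prob p q P E =
    p ^+ #|E :&: in_pairs P| * (1 - p) ^+ #|in_pairs P :\: E| *
    (q ^+ #|E :\: in_pairs P| *
     (1 - q) ^+ #|(vertex_pairs T :\: in_pairs P) :\: E|).
Proof.
rewrite powersetE => /subsetP sE; rewrite /sbm_prob /edge_prob.
rewrite (bigID (same_cluster P)) /=; congr (_ * _).
  rewrite (bigID (mem E)) /= -!prodr_const; congr (_ * _).
    rewrite [RHS](eq_bigl (fun e => (e \in vertex_pairs T) && same_cluster P e
      && (e \in E))) => [|e]; last by rewrite in_setI in_set andbC.
    by apply: eq_bigr => e /andP[/andP[_ ->] ->].
  rewrite [RHS](eq_bigl (fun e => (e \in vertex_pairs T) && same_cluster P e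
      && (e \notin E))) => [|e]; last by rewrite in_setD in_set andbC.
  by apply: eq_bigr => e /andP[/andP[_ ->] /negPf->].
rewrite (bigID (mem E)) /= -!prodr_const; congr (_ * _).
  rewrite [RHS](eq_bigl (fun e => (e \in vertex_pairs T) && ~~ same_cluster P e
    && (e \in E))) => [|e].
    by apply: eq_bigr => e /andP[/andP[_ /negPf->] ->].
  rewrite in_setD in_set; case eE: (e \in E); rewrite ?andbF // (sE e eE).
  by rewrite /= !andbT.
rewrite [RHS](eq_bigl (fun e => (e \in vertex_pairs T) && ~~ same_cluster P e
    && (e \notin E))) => [|e].
  by apply: eq_bigr => e /andP[/andP[_ /negPf->] /negPf->].
rewrite !in_setD in_set; case: (e \in E); case: (same_cluster P e);
by case: (e \in vertex_pairs T).
Qed.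

(** Moving [t] edges inside the clusters replaces [t] factors [q * (1 - p)] by [p * (1 - q)], which
    is no smaller since [q <= p]. *)
Lemma ler_sbm_prob (R : realType) (p q : R) P P' E :
  0 <= q -> q <= p -> p <= 1 -> E \in graphs T ->
  #|in_pairs P'| = #|in_pairs P| ->
  (#|E :&: in_pairs P| <= #|E :&: in_pairs P'|)%N ->
  sbm_prob p q P E <= sbm_prob p q P' E.
Proof.
move=> q0 qp p1 EG eqI leI; rewrite !sbm_prob_card //.
have subV Q : in_pairs Q \subset vertex_pairs T.
  by apply/subsetP => e; rewrite inE => /andP[].
have EV : E \subset vertex_pairs T by rewrite -powersetE.
have c1 Q : (#|E :&: in_pairs Q| + #|in_pairs Q :\: E| = #|in_pairs Q|)%N.
  by rewrite setIC cardsID.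
have c2 Q : (#|E :&: in_pairs Q| + #|E :\: in_pairs Q| = #|E|)%N.
  by rewrite cardsID.
have c3 Q : (#|E :\: in_pairs Q| + #|(vertex_pairs T :\: in_pairs Q) :\: E| =
  #|vertex_pairs T| - #|in_pairs Q|)%N.
  rewrite -[in X in (_ - X)%N](setIidPr (subV Q)) -cardsD.
  rewrite -(cardsID E (vertex_pairs T :\: in_pairs Q)); congr (_ + _)%N.
  by apply: eq_card => e; rewrite !(in_setI, in_setD); case eE: (e \in E);
     rewrite ?andbF // (subsetP EV _ eE) !andbT.
have := c1 P; have := c1 P'; have := c2 P; have := c2 P'.
have := c3 P; have := c3 P'; rewrite eqI.
move: leI; set a := #|E :&: in_pairs P|; set a' := #|E :&: in_pairs P'|.
set b := #|in_pairs P :\: E|; set b' := #|in_pairs P' :\: E|.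
set c := #|E :\: in_pairs P|; set c' := #|E :\: in_pairs P'|.
set d := #|(_ :\: in_pairs P) :\: E|.
set d' := #|(_ :\: in_pairs P') :\: E|.
move=> /subnKC <-; move: (a' - a)%N => t h1 h2 h3 h4 h5 h6.
have -> : b = (b' + t)%N by lia.
have -> : c = (c' + t)%N by lia.
have -> : d' = (d + t)%N by lia.
rewrite !exprD.
have alg1 (x y z d1 s r : R) :
  x * (y * s) * (z * r * d1) = x * y * z * d1 * (s * r) by ring.
have alg2 (x y z d1 s r : R) :
  x * s * y * (z * (d1 * r)) = x * y * z * d1 * (s * r) by ring.
rewrite alg1 alg2 -!exprMn.
rewrite ler_wpM2l ?lerXn2r ?nnegrE ?mulr_ge0 ?exprn_ge0 //; lra.
Qed.

Section Swap.
Variables (P : {set {set T}}) (B C : {set T}) (u v : T).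
Hypotheses (partP : partition P [set: T]) (BP : B \in P) (CP : C \in P).
Hypotheses (BC : B != C) (uB : u \in B) (vC : v \in C).

Definition swap_clusters : {set {set T}} :=
  [set [set tperm u v x | x in Z : {set T}] | Z in P].

Let tiP : trivIset P. Proof. by case/and3P: partP. Qed.
Let pblockB x : x \in B -> pblock P x = B.
Proof. exact: def_pblock. Qed.
Let pblockC x : x \in C -> pblock P x = C.
Proof. exact: def_pblock. Qed.
Let mem_pblock_of x : x \in pblock P x.
Proof. by rewrite mem_pblock; case/and3P: partP => /eqP-> _ _; rewrite inE. Qed.
Let BC_disj x : x \in B -> x \in C -> False.
Proof. by move=> /pblockB eB /pblockC eC; move: BC; rewrite -eB -eC eqxx. Qed.

Let imset_tpermK : involutive (fun Z : {set T} => [set tperm u v x | x in Z]).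
Proof.
move=> Z; rewrite -imset_comp -[RHS]imset_id; apply: eq_imset => x /=.
exact: tpermK.
Qed.

Lemma partition_swap : partition swap_clusters [set: T].
Proof.
case/and3P: partP => /eqP covP _ P0; apply/and3P; split.
- apply/eqP/setP => x; rewrite inE; apply/bigcupP.
  exists [set tperm u v y | y in pblock P (tperm u v x)].
    by rewrite imset_f // pblock_mem // covP inE.
  by apply/imsetP; exists (tperm u v x); rewrite ?tpermK.
- by rewrite imset_trivIset //; exact: perm_inj.
- apply/imsetP => -[Z ZP /esym/eqP]; rewrite imset_eq0 => /eqP Z0.
  by rewrite -Z0 ZP in P0.
Qed.

(** The transposition is its own inverse, so it can be moved from the partition onto the pair. *)
Lemma same_cluster_swap e :
  same_cluster swap_clusters e = same_cluster P [set tperm u v x | x in e].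
Proof.
apply/exists_inP/exists_inP => -[Z].
  case/imsetP=> Y YP -> eY; exists Y => //.
  by rewrite -[Y]imset_tpermK imsetS.
move=> ZP eZ; exists [set tperm u v x | x in Z]; first exact: imset_f.
by rewrite -[e]imset_tpermK imsetS.
Qed.

(** If the swap fixed [P], the image of [B], which contains [v], would be [C]. Since [1 < m], [B]
    has a vertex other than [u]; it does not move, so it would lie in both [B] and [C]. *)
Lemma swap_clusters_partitions k m : (1 < m)%N ->
  P \in cluster_partitions T k m ->
  swap_clusters \in cluster_partitions T k m /\ swap_clusters != P.
Proof.
move=> m1; rewrite !inE => /and3P[_ /eqP cP /forall_inP szP]; split.
  rewrite partition_swap card_imset ?cP ?eqxx /=; last exact: (inv_inj imset_tpermK).
  apply/forall_inP => _ /imsetP[Z ZP ->]; rewrite card_imset; first exact: szP.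
  exact: perm_inj.
apply/eqP => swapP.
have BsP : [set tperm u v x | x in B] \in P.
  by rewrite -[in X in _ \in X]swapP imset_f.
have vBs : v \in [set tperm u v x | x in B].
  by apply/imsetP; exists u; rewrite ?tpermL.
have BsC : [set tperm u v x | x in B] = C.
  by rewrite -(def_pblock tiP BsP vBs) pblockC.
have : (0 < #|B :\ u|)%N.
  by have := cardsD1 u B; rewrite uB (eqP (szP _ BP)); lia.
case/card_gt0P=> x; rewrite !inE => /andP[xu xB].
apply: (@BC_disj x xB); rewrite -BsC; apply/imsetP; exists x => //.
rewrite tpermD // eq_sym //; apply/eqP => xv.
by apply: (BC_disj xB); rewrite xv.
Qed.

Lemma card_in_pairs_swap : #|in_pairs swap_clusters| = #|in_pairs P|.
Proof.
rewrite -(card_imset _ (inv_inj imset_tpermK)); apply: eq_card => e.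
rewrite [in RHS]inE; apply/imsetP/andP => [[f + ->]|[eV eP]].
  rewrite inE same_cluster_swap => /andP[fV ->]; split=> //.
  by move: fV; rewrite !inE card_imset //; exact: perm_inj.
exists [set tperm u v x | x in e]; last by rewrite imset_tpermK.
rewrite inE same_cluster_swap imset_tpermK eP andbT.
by move: eV; rewrite !inE card_imset //; exact: perm_inj.
Qed.

(** A pair avoiding [u] and [v] is fixed by the transposition. An inside pair that is lost thus
    joins [u] to [B] or [v] to [C]. *)
Lemma lost_pairs E : E \in graphs T ->
  (E :&: in_pairs P) :\: in_pairs swap_clusters \subset
  (E :&: star u (B :\ u)) :|: (E :&: star v (C :\ v)).
Proof.
move=> EG; apply/subsetP => e; rewrite in_setD in_setI => /and3P[eP' eE eP].
rewrite -setIUr in_setI eE in_setU /=.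
have [x [y [xy e_xy]]] : exists x y, x != y /\ e = [set x; y].
  by apply/cards2P; move: EG eE; rewrite powersetE => /subsetP VE /VE; rewrite inE.
have{eP'} eP' : ~~ same_cluster swap_clusters e.
  by move: eP eP'; rewrite !inE => /andP[-> _].
have{eP} /eqP eP : pblock P x == pblock P y.
  by move: eP; rewrite inE e_xy same_cluster_pair // => /andP[].
have in_star z (Z : {set T}) a : Z \in P -> z \in Z -> e = [set z; a] ->
    z != a -> pblock P z = pblock P a -> e \in star z (Z :\ z).
  move=> ZP zZ -> za Za; apply/imsetP; exists a; rewrite // !inE eq_sym za.
  by rewrite -(def_pblock tiP ZP zZ) Za mem_pblock_of.
have e_yx : e = [set y; x] by rewrite e_xy setUC.
have [xu|xu] := eqVneq x u.
  by rewrite xu in e_xy xy eP; rewrite (in_star u B y).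
have [yu|yu] := eqVneq y u.
  by rewrite yu in e_yx xy eP; rewrite (in_star u B x) // eq_sym.
have [xv|xv] := eqVneq x v.
  by rewrite xv in e_xy xy eP; rewrite (in_star v C y) ?orbT.
have [yv|yv] := eqVneq y v.
  by rewrite yv in e_yx xy eP; rewrite (in_star v C x) ?orbT // eq_sym.
case/negP: eP'; rewrite same_cluster_swap e_xy imsetU1 imset_set1.
by rewrite !tpermD 1?eq_sym // same_cluster_pair // eP.
Qed.

(** After the swap [u] lies with [C :\ v] and [v] with [B :\ u]; the pair of [u] and [v] itself
    stays across clusters. *)
Lemma gained_pairs E :
  (E :&: star u (C :\ v)) :|: (E :&: star v (B :\ u)) \subset
  (E :&: in_pairs swap_clusters) :\: in_pairs P.
Proof.
have uv : u != v by apply/eqP => uv; apply: (BC_disj uB); rewrite uv.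
have same x y : same_cluster P [set x; y] = (pblock P x == pblock P y).
  exact: same_cluster_pair.
apply/subsetP => e; rewrite -setIUr in_setD !in_setI in_setU.
case/andP=> -> /orP[] /imsetP[y]; rewrite !inE => /andP[yz yZ] ->.
  have yu : y != u by apply/eqP => yu; apply: (BC_disj uB); rewrite -yu.
  rewrite cards2 (eq_sym u) yu same_cluster_swap imsetU1 imset_set1 tpermL.
  rewrite tpermD 1?eq_sym // !same (pblockC vC) (pblockC yZ) (pblockB uB) eqxx.
  by rewrite (negPf BC).
have yv : y != v by apply/eqP => yv; apply: (BC_disj yZ); rewrite yv.
rewrite cards2 (eq_sym v) yv same_cluster_swap imsetU1 imset_set1 tpermR.
rewrite tpermD 1?eq_sym // !same (pblockC vC) (pblockB yZ) (pblockB uB) eqxx.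
by rewrite (eq_sym C) (negPf BC).
Qed.

Lemma leq_in_pairs_swap E : E \in graphs T ->
  fewer (star u (B :\ u)) (star u C) E -> fewer (star v (C :\ v)) (star v B) E ->
  (#|E :&: in_pairs P| <= #|E :&: in_pairs swap_clusters|)%N.
Proof.
move=> EG; rewrite /fewer => fu fv.
(* The pair of [u] and [v] is counted in both [star u C] and [star v B] but is not gained; the two
   strict inequalities pay for these two units. *)
have star_drop z (Z : {set T}) x : (#|E :&: star z Z| <= #|E :&: star z (Z :\ x)|.+1)%N.
  have : E :&: star z Z \subset [set z; x] |: (E :&: star z (Z :\ x)).
    apply/subsetP => e; rewrite !inE => /andP[-> /imsetP[y yZ ->]] /=.
    by have [->|yx] := eqVneq y x; rewrite ?eqxx // mem_star ?orbT // !inE yx.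
  move=> /subset_leq_card /leq_trans; apply.
  by rewrite cardsU1 -add1n leq_add2r leq_b1.
have dstar : [disjoint E :&: star u (C :\ v) & E :&: star v (B :\ u)].
  rewrite -setI_eq0; apply/eqP/setP => e; rewrite !inE; apply/negbTE/negP.
  case/andP=> /andP[_ /imsetP[x + ->]] /andP[_ /imsetP[y + /setP/(_ u)]].
  rewrite !inE eqxx => /andP[xv xC] /andP[yu yB] /esym/orP[/eqP uv|/eqP uy].
    by apply: (BC_disj uB); rewrite uv.
  by rewrite uy eqxx in yu.
have := subset_leq_card (lost_pairs EG).
have := subset_leq_card (gained_pairs E).
have := star_drop u C v; have := star_drop v B u.
have [+ _] := leq_card_setU (E :&: star u (B :\ u)) (E :&: star v (C :\ v)).
have := cardsID (in_pairs swap_clusters) (E :&: in_pairs P).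
have := cardsID (in_pairs P) (E :&: in_pairs swap_clusters).
rewrite (cardsU (E :&: star u (C :\ v))) (disjoint_setI0 dstar) cards0 subn0.
rewrite (setIAC E (in_pairs swap_clusters)).
move: (in_pairs swap_clusters) (in_pairs P) => I' I.
lia.
Qed.

End Swap.
End Clusters.

(** * Bayes risk of the best guess *)

Section Recovery.
Variables (R : realType) (T : finType) (p q : R).
Implicit Types (P E : {set {set T}}) (B C : {set T}).

(** [bern] ranges over all families of vertex sets; weight 0 off [vertex_pairs] confines it to
    [graphs]. *)
Definition edge_weight P (e : {set T}) : R :=
  if e \in vertex_pairs T then edge_prob p q P e else 0.

Lemma sum_sbm_prob P (F : {set {set T}} -> R) :
  \sum_(E in graphs T) sbm_prob p q P E * F E = expect (edge_weight P) F.
Proof.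
rewrite big_mkcond; apply: eq_bigr => E _; rewrite powersetE.
case: ifP => [/subsetP EV|/negbT/subsetPn[e eE eV]].
  congr (_ * _); rewrite /bern /sbm_prob big_mkcond; apply: eq_bigr => e _.
  rewrite /edge_weight; case: ifPn => // eV.
  by case: ifPn => [/EV|]; rewrite ?(negPf eV) ?subr0.
by rewrite /bern (bigD1 e) //= eE /edge_weight (negPf eV) !mul0r.
Qed.

Hypotheses (q0 : 0 < q) (qp : q <= p) (p1 : p < 1).

Lemma edge_weight01 P e : 0 <= edge_weight P e <= 1.
Proof.
have [q_gt0 q_le_p p_lt1] := And3 q0 qp p1.
rewrite /edge_weight /edge_prob; by apply/andP; case: ifP => _; first case: ifP => _; split; lra.
Qed.

(** * Second moment bound for two fixed clusters *)

Section FixedPartition.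
Variables (P : {set {set T}}) (n : nat) (B C : {set T}).
Hypotheses (partP : partition P [set: T]) (BP : B \in P) (CP : C \in P).
Hypotheses (BC : B != C) (cB : #|B| = n.+1) (cC : #|C| = n.+1).

Let tiP : trivIset P. Proof. by case/and3P: partP. Qed.
Let BC_disj x : x \in B -> x \in C -> False.
Proof.
move=> xB xC; move: BC.
by rewrite -(def_pblock tiP BP xB) -(def_pblock tiP CP xC) eqxx.
Qed.

Lemma edge_weight_in u : u \in B ->
  {in star u (B :\ u), forall e, edge_weight P e = p}.
Proof.
move=> uB e /imsetP[x + ->]; rewrite !inE => /andP[xu xB].
rewrite /edge_weight /edge_prob inE cards2 (eq_sym u) xu /= same_cluster_pair //.
by rewrite (def_pblock tiP BP xB) (def_pblock tiP BP uB) eqxx.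
Qed.

Lemma edge_weight_out u : u \in B ->
  {in star u C, forall e, edge_weight P e = q}.
Proof.
move=> uB e /imsetP[x xC ->]; have ux : u != x.
  by apply/eqP => ux; apply: (BC_disj uB); rewrite ux.
rewrite /edge_weight /edge_prob inE cards2 ux /= same_cluster_pair //.
by rewrite (def_pblock tiP CP xC) (def_pblock tiP BP uB) (negPf BC).
Qed.

(** The number [a] bounds the probability for each vertex from below, so the mean is at least 8.
    With correlation factor at most 9/8, [prob_exists_ge] gives 2 - 1/8 - 9/8 = 3/4. *)
Lemma prob_exists_fewer j (a : R) : (j <= n)%N ->
  a = 'C(n, j)%:R * (p ^+ j * (1 - p) ^+ (n - j)) *
    ('C(n.+1, j.+1)%:R * (q ^+ j.+1 * (1 - q) ^+ (n - j))) ->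
  8 <= n.+1%:R * a -> (1 - p) ^- 2 <= 9 / 8 ->
  3 / 4 <= prob (edge_weight P)
    (fun E => [exists u in B, fewer (star u (B :\ u)) (star u C) E]).
Proof.
have [q_gt0 q_le_p p_lt1] := And3 q0 qp p1.
move=> jn aE a8 p98; pose mu := \sum_(u in B)
  prob (edge_weight P) (fewer (star u (B :\ u)) (star u C)).
have mu8 : 8 <= mu.
  apply: le_trans a8 _; rewrite -cB mulr_natl -sumr_const; apply: ler_sum => u uB.
  rewrite aE; apply: prob_ltn_ge => //.
  - exact: edge_weight01.
  - exact: edge_weight_in.
  - exact: edge_weight_out.
  - rewrite -setI_eq0; apply/eqP/setP => e; rewrite !inE; apply/negbTE/negP.
    case/andP=> /imsetP[x + ->] /imsetP[y yC /set2_injr xy].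
    by rewrite xy !inE => /andP[_ yB]; exact: (BC_disj yB).
  - by rewrite card_star; have := cardsD1 u B; rewrite uB cB => -[].
  - by rewrite card_star.
have mu0 : 0 < mu by lra.
have corr : {in B &, forall u u', u != u' ->
    prob (edge_weight P)
      (predI (fewer (star u (B :\ u)) (star u C))
             (fewer (star u' (B :\ u')) (star u' C))) <=
    (1 - p) ^- 2 *
      (prob (edge_weight P) (fewer (star u (B :\ u)) (star u C)) *
       prob (edge_weight P) (fewer (star u' (B :\ u')) (star u' C)))}.
  move=> u u' uB u'B uu'.
  have edge_out x : x \in B -> [set u; u'] \notin star x C.
    move=> xB; apply/imsetP => -[y yC /setP/(_ y)].
    by rewrite !inE eqxx orbT => /orP[]/eqP yE; apply: (@BC_disj y); rewrite // yE.
  have edge_eq (Z : {set T}) e : e \in star u Z -> u' \in e ->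
      (u' \in Z) && (e == [set u; u']).
    case/imsetP=> x xZ ->; rewrite !inE eq_sym (negPf uu') /= => /eqP->.
    by rewrite xZ eqxx.
  (* The pair of [u] and [u'] is the only one that meets the stars of both vertices. *)
  apply: (@prob_ltn_corr _ _ _ _ _ _ _ _ [set u; u']) => //.
  - exact: edge_weight01.
  - by apply: (edge_weight_in uB); rewrite mem_star // !inE eq_sym uu'.
  - rewrite -setI_eq0; apply/eqP/setP => e; rewrite [RHS]inE.
    apply/negbTE/negP => /setIP[e1 e2].
    have u'e : u' \in e.
      by case/setUP: e2 => [/setD1P[_]|] /imsetP[x _ ->]; rewrite !inE eqxx.
    case/setUP: e1 => [/setD1P[ne eu]|eu].
      by move: (edge_eq _ _ eu u'e); rewrite (negPf ne) andbF.
    by move: (edge_eq _ _ eu u'e) => /andP[/(BC_disj u'B)].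
  - exact: edge_out.
  - exact: edge_out.
have K0 : 0 <= (1 - p) ^- 2 by rewrite invr_ge0 exprn_ge0 //; lra.
apply: le_trans (prob_exists_ge (edge_weight01 P) mu0 erefl K0 corr).
have : mu^-1 <= 8^-1 by rewrite lef_pV2 ?posrE //; lra.
lra.
Qed.

End FixedPartition.

(* The best guess [Q] of the hidden partition is wrong at least half of the
   time when [Q] is bad, and always when another partition is hidden. *)
Lemma recovery_prob_le k m (A : {set {set T}} -> {set {set T}} -> R)
    (bad : {set {set T}} -> pred {set {set T}}) (c : R) :
  is_procedure A -> c <= 2 ->
  (forall P E, P \in cluster_partitions T k m -> E \in graphs T -> bad P E ->
     exists2 P', P' \in cluster_partitions T k m &
       P' != P /\ sbm_prob p q P E <= sbm_prob p q P' E) ->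
  {in cluster_partitions T k m, forall P, c <= prob (edge_weight P) (bad P)} ->
  recovery_prob k m p q A <= 1 - c / 2.
Proof.
have [q_gt0 q_le_p p_lt1] := And3 q0 qp p1.
move=> procA c2 badP probbad; rewrite /recovery_prob.
set CP := cluster_partitions T k m in badP probbad *.
have sbm_ge0 P E : 0 <= sbm_prob p q P E.
  apply: prodr_ge0 => e _; rewrite /edge_prob.
  by case: ifP => _; case: ifP => _; lra.
have perE E : E \in graphs T ->
    \sum_(P in CP) sbm_prob p q P E * A E P <=
    \sum_(P in CP) sbm_prob p q P E * (1 - (bad P E)%:R / 2).
  move=> EG; have [A0 A1] := procA E.
  have term_ge0 P : 0 <= sbm_prob p q P E * (1 - (bad P E)%:R / 2).
    by rewrite mulr_ge0 //; case: (bad P E) => /=; lra.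
  case: (set_0Vmem CP) => [->|[P1 P1CP]]; first by rewrite !big_set0.
  (* For a fixed graph, every procedure scores at most the largest likelihood, attained at [Q]. *)
  case: (arg_maxP (fun P => sbm_prob p q P E) P1CP) => Q QCP Qmax.
  apply: (@le_trans _ _ (sbm_prob p q Q E)).
    apply: (@le_trans _ _ (\sum_(P in CP) sbm_prob p q Q E * A E P)).
      by apply: ler_sum => P PCP; rewrite ler_wpM2r //; exact: Qmax.
    rewrite -mulr_sumr ler_piMr // -A1 [leRHS](bigID (mem CP)) /= lerDl.
    exact: sumr_ge0.
  rewrite (bigD1 Q) //=; case badQ: (bad Q E); last first.
    by rewrite mul0r subr0 mulr1 lerDl; apply: sumr_ge0.
  (* The terms of [Q] and [Q'] each keep at least half of their weight, and [Q'] is at least as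
     likely as [Q], so together they cover the likelihood of [Q]. *)
  have [Q' Q'CP [Q'Q leQ]] := badP Q E QCP EG badQ.
  rewrite (bigD1 Q') ?Q'CP //=.
  have : 0 <= \sum_(P | (P \in CP) && (P != Q) && (P != Q'))
      sbm_prob p q P E * (1 - (bad P E)%:R / 2) by apply: sumr_ge0.
  have : sbm_prob p q Q' E / 2 <=
         sbm_prob p q Q' E * (1 - (bad Q' E)%:R / 2).
    by rewrite ler_wpM2l //; case: (bad Q' E) => /=; lra.
  by rewrite /=; lra.
have sum_le : \sum_(P in CP) success_prob p q P A <= #|CP|%:R * (1 - c / 2).
  rewrite /success_prob exchange_big /=.
  apply: le_trans (ler_sum _ perE) _; rewrite exchange_big /=.
  rewrite mulr_natl -sumr_const; apply: ler_sum => P PCP.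
  rewrite sum_sbm_prob; have := probbad P PCP.
  have -> : expect (edge_weight P) (fun E => 1 - (bad P E)%:R / 2) =
            1 - prob (edge_weight P) (bad P) / 2.
    rewrite -[in X in X - _](expect_const (edge_weight P) 1) /prob /expect.
    by rewrite mulr_suml -sumrB; apply: eq_bigr => E _; ring.
  by lra.
(* With no partition at all, [recovery_prob] is 0 since the inverse of 0 is 0, and [c <= 2]
   concludes. *)
case: (posnP #|CP|) => [->|CP0]; first by rewrite invr0 mul0r; lra.
by rewrite mulrC ler_pdivrMr ?ltr0n // mulrC.
Qed.

(** Two events of probability at least 3/4 occur together with probability at least 1/2; then
    [recovery_prob_le] with [c = 1 / 2] gives 3/4. *)
Lemma recovery_prob_le34 k n j (A : {set {set T}} -> {set {set T}} -> R) :
  (2 <= k)%N -> (0 < n)%N -> is_procedure A -> (j <= n)%N ->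
  8 <= n.+1%:R * ('C(n, j)%:R * (p ^+ j * (1 - p) ^+ (n - j)) *
    ('C(n.+1, j.+1)%:R * (q ^+ j.+1 * (1 - q) ^+ (n - j)))) ->
  (1 - p) ^- 2 <= 9 / 8 ->
  recovery_prob k n.+1 p q A <= 3 / 4.
Proof.
have [q_gt0 q_le_p p_lt1] := And3 q0 qp p1.
move=> k2 n0 procA jn a8 p98.
pose ex B C E := [exists u in B, fewer (star u (B :\ u)) (star u C) E].
pose bad P E := [exists B in P, [exists C in P,
  [&& B != C, ex B C E & ex C B E]]].
apply: le_trans (@recovery_prob_le k n.+1 A bad (1 / 2) procA _ _ _) _; last 1 first.
- lra.
- lra.
- move=> P E PCP EG /exists_inP[B BP /exists_inP[C CP /and3P[BC]]].
  case/exists_inP=> u uB fu /exists_inP[v vC fv].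
  have partP : partition P [set: T] by move: PCP; rewrite inE => /and3P[].
  have [sCP sP] :=
    swap_clusters_partitions partP BP CP BC uB vC (n0 : (1 < n.+1)%N) PCP.
  exists (swap_clusters P u v) => //; split=> //.
  apply: ler_sbm_prob; rewrite // ?ltW //.
    exact: card_in_pairs_swap.
  by have := leq_in_pairs_swap partP BP CP BC uB vC EG fu fv.
move=> P PCP; have partP : partition P [set: T].
  by move: PCP; rewrite inE => /and3P[].
move: (PCP); rewrite inE => /and3P[_ /eqP cP /forall_inP szP].
have /card_gt1P[B [C [BP CP BC]]] : (1 < #|P|)%N by rewrite cP.
have cB := eqP (szP B BP); have cC := eqP (szP C CP).
have hB := prob_exists_fewer partP BP CP BC cB cC jn erefl a8 p98.
have CB : C != B by rewrite eq_sym.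
have hC := prob_exists_fewer partP CP BP CB cC cB jn erefl a8 p98.
have := probI_ge (edge_weight01 P) (ex B C) (ex C B).
have : prob (edge_weight P) (predI (ex B C) (ex C B)) <=
       prob (edge_weight P) (bad P).
  apply: ler_prob => [|E /= /andP[e1 e2]]; first exact: edge_weight01.
  apply/exists_inP; exists B => //; apply/exists_inP; exists C => //.
  by rewrite BC e1 e2.
rewrite -/(ex B C) -/(ex C B) in hB hC; lra.
Qed.

End Recovery.

(** * Asymptotic estimates *)

Section Asymptotics.
Variable R : realType.
Implicit Types (x y p q : R).

(** Cube [x / 3 <= expR (x / 3)]. The third power is what beats the factors [L ^+ 2] below. *)
Lemma expR_ge_cube x : 0 <= x -> (x / 3) ^+ 3 <= expR x.
Proof.
move=> x0; have -> : x = 3%:R * (x / 3) by field.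
rewrite expRM_natl (_ : 3%:R * _ / 3 = x / 3); last by field.
by rewrite lerXn2r ?nnegrE ?expR_ge0 //; have := expR_ge1Dx (x / 3); lra.
Qed.

(** A weak Stirling bound, by induction; the step is the [n.+2]-th power of
    [1 - n.+2%:R^-1 <= expR (- n.+2%:R^-1)]. *)
Lemma fact_expR_le n : n.+1`!%:R * expR n%:R <= n.+1%:R ^+ n.+2 :> R.
Proof.
elim: n => [|n IH]; first by rewrite expR0 mulr1 expr1n.
have n2 : 0 < n.+2%:R :> R by rewrite ltr0n.
have step : expR 1 * n.+1%:R ^+ n.+2 <= n.+2%:R ^+ n.+2 :> R.
  rewrite mulrC -ler_pdivlMr ?expR_gt0 // -expRN.
  rewrite (_ : - 1 = n.+2%:R * - n.+2%:R^-1 :> R); last first.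
    by rewrite mulrN mulfV ?gt_eqF.
  rewrite expRM_natl -exprMn lerXn2r ?nnegrE ?mulr_ge0 ?expR_ge0 //.
  have := expR_ge1Dx (- n.+2%:R^-1 : R); rewrite -(ler_pM2l n2).
  by apply: le_trans; rewrite mulrDr mulrN mulfV ?gt_eqF // mulr1 -natr1; lra.
rewrite factS natrM -[in expR _]natr1 expRD.
have -> : n.+2%:R * n.+1`!%:R * (expR n%:R * expR 1) =
  n.+2%:R * (expR 1 * (n.+1`!%:R * expR n%:R)) :> R by ring.
rewrite [leRHS]exprS ler_pM2l //; apply: le_trans step.
by rewrite ler_pM2l ?expR_gt0.
Qed.

Lemma bernoulli_ge y n : 0 <= y <= 1 -> 1 - n%:R * y <= (1 - y) ^+ n.
Proof.
move=> y01; elim: n => [|n IH]; first by rewrite mul0r subr0.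
rewrite exprS; have : (1 - y) * (1 - n%:R * y) <= (1 - y) * (1 - y) ^+ n.
  by rewrite ler_wpM2l //; lra.
have : 0 <= n%:R * y ^+ 2 by rewrite mulr_ge0 ?sqr_ge0.
by rewrite -natr1; nra.
Qed.

(** For one factor, [(1 - p) * (1 + p + 2 * p ^+ 2)] equals [1 + p ^+ 2 * (1 - 2 * p)], which is at
    least 1. *)
Lemma expr_onem_ge p n : 0 <= p <= 1 / 2 ->
  expR (- (n%:R * p + 2 * (n%:R * p ^+ 2))) <= (1 - p) ^+ n.
Proof.
case/andP=> p0 p2; have p1 : 0 < 1 - p by lra.
rewrite (_ : - _ = n%:R * - (p + 2 * p ^+ 2)); last by ring.
rewrite expRM_natl lerXn2r ?nnegrE ?expR_ge0 ?(ltW p1) //.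
rewrite expRN invf_ple ?posrE ?expR_gt0 //.
apply: le_trans (expR_ge1Dx _).
rewrite -[leLHS]mul1r ler_pdivrMr //.
have : 0 <= p * p * (1 - 2 * p) by rewrite !mulr_ge0 //; lra.
nra.
Qed.

Lemma expn_leq_ffact n j : ((n.+1 - j) ^ j <= n ^_ j)%N.
Proof.
elim: j => // j IH; rewrite ffactnSr expnSr subSS leq_mul //.
by apply: leq_trans IH; case: j => // j; rewrite leq_exp2r // leq_sub2r.
Qed.

(** The falling factorial is at least [(n.+1 - j) ^ j], and Bernoulli's inequality shows that this
    loses at most a factor 2 from [n.+1 ^ j]. *)
Lemma bin_ge n j : (j <= n)%N -> j%:R ^+ 2 <= n.+1%:R / 2 :> R ->
  n.+1%:R ^+ j <= 2 * j`!%:R * 'C(n, j)%:R :> R.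
Proof.
move=> jn j2; have m0 : 0 < n.+1%:R :> R by rewrite ltr0n.
have y1 : j%:R / n.+1%:R <= 1 :> R.
  by rewrite ler_pdivrMr // mul1r ler_nat leqW.
have y0 : 0 <= j%:R / n.+1%:R :> R by rewrite divr_ge0.
have half : 1 / 2 <= (1 - j%:R / n.+1%:R) ^+ j :> R.
  apply: le_trans (bernoulli_ge _ _); last by rewrite y0 y1.
  rewrite lerBrDr -lerBrDl mulrA -expr2 ler_pdivrMr //.
  by rewrite (_ : 1 - 1 / 2 = 2^-1 :> R) 1?mulrC //; field.
have ff : n.+1%:R ^+ j * (1 - j%:R / n.+1%:R) ^+ j <= 'C(n, j)%:R * j`!%:R :> R.
  rewrite -natrM bin_ffact -exprMn mulrBr mulr1 mulrCA mulfV ?gt_eqF // mulr1.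
  by rewrite -natrB 1?leqW // -natrX ler_nat expn_leq_ffact.
have : n.+1%:R ^+ j * (1 / 2) <= n.+1%:R ^+ j * (1 - j%:R / n.+1%:R) ^+ j :> R.
  by rewrite ler_wpM2l ?exprn_ge0.
nra.
Qed.

Lemma bin_mul_expr_ge n j x : (0 < j <= n)%N ->
  j%:R ^+ 2 <= n.+1%:R / 2 :> R -> j%:R <= x < j.+1%:R ->
  expR (x - 2) / (2 * x) <= 'C(n, j)%:R * (x / n.+1%:R) ^+ j.
Proof.
case/andP=> j0 jn j2 /andP[jx xj]; have m0 : 0 < n.+1%:R :> R by rewrite ltr0n.
have jR0 : 0 < j%:R :> R by rewrite ltr0n.
have x0 : 0 < x by lra.
have fact0 : 0 < j`!%:R :> R by rewrite ltr0n fact_gt0.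
have eC : x ^+ j / (2 * j`!%:R) <= 'C(n, j)%:R * (x / n.+1%:R) ^+ j.
  rewrite expr_div_n mulrCA ler_pM2l ?exprn_gt0 //.
  rewrite ler_pdivlMr ?exprn_gt0 // mulrC ler_pdivrMr ?mulr_gt0 // mulrC.
  exact: bin_ge.
apply: le_trans eC; rewrite ler_pdivrMr ?mulr_gt0 // mulrAC.
rewrite ler_pdivlMr ?mulr_gt0 //.
have ef : j`!%:R * expR (x - 2) <= x ^+ j.+1.
  case: j j0 jx xj {jn j2 jR0 fact0} => // j _ jx xj.
  apply: (@le_trans _ _ (j.+1`!%:R * expR j%:R)).
    rewrite ler_wpM2l // ler_expR; move: xj; rewrite -natr1 -natr1; lra.
  by apply: le_trans (fact_expR_le j) _; rewrite lerXn2r ?nnegrE // ltW.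
by move: ef; rewrite exprSr; nra.
Qed.

(** Raise the exponent to [n.+1]: then [n.+1%:R * p] is [c * L], and the quadratic correction is at
    most 1 by the lower bound on [n.+1]. *)
Lemma expr_onem_ge_log c L p n i : 0 < c -> 0 < L -> (i <= n.+1)%N ->
  2 * c ^+ 2 * L ^+ 2 <= n.+1%:R -> p = c * L / n.+1%:R -> p <= 1 / 2 ->
  expR (- (c * L) - 1) <= (1 - p) ^+ i.
Proof.
move=> c0 L0 i_le cL pE p2; have m0 : 0 < n.+1%:R :> R by rewrite ltr0n.
have p0 : 0 < p by rewrite pE divr_gt0 // mulr_gt0.
apply: (@le_trans _ _ ((1 - p) ^+ n.+1)); last first.
  by rewrite ler_wiXn2l //; lra.
apply: le_trans (expr_onem_ge _ _); last by apply/andP; split; lra.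
have mp : n.+1%:R * p = c * L by rewrite pE mulrC divfK ?gt_eqF.
have mp2 : n.+1%:R * p ^+ 2 = c ^+ 2 * L ^+ 2 / n.+1%:R.
  by rewrite pE; move: m0; move: n.+1%:R => m m0; field; rewrite gt_eqF.
have : c ^+ 2 * L ^+ 2 / n.+1%:R <= 1 / 2.
  by rewrite ler_pdivrMr // mul1r ler_pdivlMl // mulrA.
by rewrite ler_expR mp mp2; move: (_ * _ / _) => z z_le; lra.
Qed.

(* With [L = ln m] and [j ~ sqrt (alpha beta) L], the quantity bounded below is
   of order [expR (delta L) / L ^ 2]. *)
Lemma expected_number_ge8 (alpha beta : R) :
  0 < beta -> beta < alpha -> Num.sqrt alpha - Num.sqrt beta < 1 ->
  exists K : R, forall n, K <= ln n.+1%:R ->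
    let p : R := alpha * ln n.+1%:R / n.+1%:R in
    let q : R := beta * ln n.+1%:R / n.+1%:R in
    [/\ (0 < n)%N, 0 < q, q <= p, p < 1 & (1 - p) ^- 2 <= 9 / 8] /\
    exists2 j, (j <= n)%N &
      8 <= n.+1%:R * ('C(n, j)%:R * (p ^+ j * (1 - p) ^+ (n - j)) *
        ('C(n.+1, j.+1)%:R * (q ^+ j.+1 * (1 - q) ^+ (n - j)))).
Proof.
move=> b0 ba gap; pose tau := Num.sqrt alpha * Num.sqrt beta.
(* This is 1 minus the square of the gap, hence positive. *)
pose delta := 1 + 2 * tau - alpha - beta.
have a0 : 0 < alpha by lra.
have sb0 : 0 < Num.sqrt beta by rewrite sqrtr_gt0.
have sba : Num.sqrt beta < Num.sqrt alpha by rewrite ltr_sqrt.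
have tau0 : 0 < tau by rewrite mulr_gt0 // sqrtr_gt0.
have sqa := sqr_sqrtr (ltW a0); have sqb := sqr_sqrtr (ltW b0).
have tau2 : tau ^+ 2 = alpha * beta by rewrite exprMn sqa sqb.
have delta0 : 0 < delta.
  rewrite /delta -[in X in _ - X - _]sqa -[in X in _ - _ - X]sqb /tau; nra.
have deltaE : delta = 1 + 2 * tau - alpha - beta by [].
clearbody delta tau; pose K0 := 1728 * tau ^+ 3 * expR 6 / (beta * delta ^+ 3).
(* The summands serve in turn [1 <= L], [p <= 1 / 18] (486 = 27 * 18), the bound on [j ^ 2], the two
   quadratic corrections, [1 <= tau * L], and the final inequality, where 1728 = 8 * 216. *)
exists (1 + 486 * alpha + 54 * (alpha * beta) + 54 * alpha ^+ 2 + tau^-1 + K0).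
move=> n; set m : R := n.+1%:R; set L := ln m => KL p q.
have mn : n.+1%:R = m by [].
have m0 : 0 < m by rewrite ltr0n.
have mE : m = expR L by rewrite lnK.
have pE : p = alpha * L / m by [].
have qE : q = beta * L / m by [].
clearbody p q L m.
have K0_ge0 : 0 <= K0.
  by apply/ltW/divr_gt0; rewrite ?(exprn_gt0, expR_gt0, mulr_gt0, ltr0n).
have K0E : K0 = 1728 * tau ^+ 3 * expR 6 / (beta * delta ^+ 3) by [].
clearbody K0; have tauV0 : 0 < tau^-1 by rewrite invr_gt0.
have ab0 : 0 < alpha * beta by rewrite mulr_gt0.
have aa0 : 0 < alpha ^+ 2 by rewrite exprn_gt0.
have L1 : 1 <= L by lra.
have L0 : 0 < L by lra.
have mL : L ^+ 3 <= 27 * m.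
  have := expR_ge_cube (ltW L0); rewrite -mE expr_div_n ler_pdivrMr; last by lra.
  by lra.
have Lm c : 0 <= c -> c * 27 <= L -> c * L ^+ 2 <= m.
  move=> c0 cL; have : c * 27 * L ^+ 2 <= L ^+ 3.
    by rewrite [leRHS]exprS ler_wpM2r ?sqr_ge0.
  lra.
have L2 : L <= L ^+ 2 by rewrite expr2; nra.
(* Chosen because [(17 / 18) ^+ 2] exceeds 8/9, which yields the bound 9/8 on [(1 - p) ^- 2]. *)
have p18 : p <= 1 / 18.
  rewrite pE ler_pdivrMr //; have : 18 * alpha * L ^+ 2 <= m by apply: Lm; lra.
  have : alpha * L <= alpha * L ^+ 2 by rewrite ler_pM2l.
  lra.
have q0 : 0 < q by rewrite qE divr_gt0 // mulr_gt0.
have qp : q <= p by rewrite pE qE ler_pM2r ?invr_gt0 // ler_pM2r // ltW.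
have tauL1 : 1 <= tau * L.
  by rewrite mulrC -ler_pdivrMr // mul1r; lra.
have tauL0 : 0 < tau * L by lra.
pose j := Num.truncn (tau * L).
have /andP[jle jlt] := truncn_itv (ltW tauL0).
rewrite -/j in jle jlt.
have j0 : (0 < j)%N by rewrite truncn_ge_nat // ltW.
have j2 : j%:R ^+ 2 <= m / 2 :> R.
  apply: (@le_trans _ _ ((tau * L) ^+ 2)).
    by rewrite lerXn2r ?nnegrE // ltW.
  rewrite exprMn tau2.
  have : 2 * (alpha * beta) * L ^+ 2 <= m by apply: Lm; lra.
  lra.
have jn : (j <= n)%N.
  have : (j ^ 2)%N%:R < m by rewrite natrX; lra.
  rewrite -mn ltr_nat ltnS; apply: leq_trans.
  by rewrite expnS expn1 leq_pmull.
split.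
  split=> //; first by apply: leq_trans jn.
    lra.
  rewrite invf_ple ?posrE ?exprn_gt0 //; try lra.
  apply: (@le_trans _ _ ((17 / 18) ^+ 2)); first by lra.
  by rewrite lerXn2r ?nnegrE //; lra.
exists j => //.
have jR0 : 0 < j.+1%:R :> R by rewrite ltr0n.
have binE : 'C(n.+1, j.+1)%:R = m * 'C(n, j)%:R / j.+1%:R :> R.
  apply: (mulIf (lt0r_neq0 jR0)).
  by rewrite divfK ?gt_eqF // -mn -!natrM mul_bin_diag mulnC.
pose G := 'C(n, j)%:R * (tau * L / m) ^+ j.
have GE : expR (tau * L - 2) / (2 * (tau * L)) <= G.
  by rewrite /G -mn; apply: bin_mul_expr_ge; rewrite ?j0 ?mn // jle.
have aL : 2 * alpha ^+ 2 * L ^+ 2 <= m by apply: Lm; lra.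
have bL : 2 * beta ^+ 2 * L ^+ 2 <= m.
  have : beta ^+ 2 <= alpha ^+ 2 by rewrite lerXn2r ?nnegrE // ltW.
  by have := sqr_ge0 L; nra.
have nj : (n - j <= n.+1)%N by rewrite leqW // leq_subr.
rewrite -mn in aL bL pE qE.
have hp : expR (- (alpha * L) - 1) <= (1 - p) ^+ (n - j).
  by apply: expr_onem_ge_log a0 L0 nj aL pE _; lra.
have hq : expR (- (beta * L) - 1) <= (1 - q) ^+ (n - j).
  by apply: expr_onem_ge_log b0 L0 nj bL qE _; lra.
rewrite mn in aL bL pE qE.
(* As [p * q] is the square of [tau * L / m], and [binE] turns the second binomial coefficient into
   the first, both binomial terms merge into [G ^+ 2]. *)
have target : m * ('C(n, j)%:R * (p ^+ j * (1 - p) ^+ (n - j)) *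
    ('C(n.+1, j.+1)%:R * (q ^+ j.+1 * (1 - q) ^+ (n - j)))) =
  beta * L / j.+1%:R * m * G ^+ 2 * ((1 - p) ^+ (n - j) * (1 - q) ^+ (n - j)).
  have pq : p ^+ j * q ^+ j = (tau * L / m) ^+ j * (tau * L / m) ^+ j.
    rewrite -!exprMn; congr (_ ^+ j).
    transitivity (tau ^+ 2 * L ^+ 2 / m ^+ 2); last by field; rewrite gt_eqF.
    by rewrite tau2 pE qE; field; rewrite gt_eqF.
  have mq : m * q = beta * L by rewrite qE mulrC divfK ?gt_eqF.
  rewrite binE exprS /G expr2.
  move: ((1 - p) ^+ (n - j)) ((1 - q) ^+ (n - j)) pq => P' Q' pq.
  transitivity ((m * q) / j.+1%:R * m *
    ('C(n, j)%:R ^+ 2 * (p ^+ j * q ^+ j)) * (P' * Q')); last first.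
    by rewrite mq pq; move: (_ ^+ j) => z; ring.
  by move: (p ^+ j) (q ^+ j) => y z; ring.
rewrite target.
apply: (@le_trans _ _ (beta * L / (2 * (tau * L)) * m *
    (expR (tau * L - 2) / (2 * (tau * L))) ^+ 2 *
    (expR (- (alpha * L) - 1) * expR (- (beta * L) - 1)))); last first.
  have tL : 0 < 2 * (tau * L) by rewrite mulr_gt0.
  have step a1 a2 g1 g2 r1 r2 : 0 <= a1 -> a1 <= a2 -> 0 <= g1 -> g1 <= g2 ->
      0 <= r1 -> r1 <= r2 -> a1 * m * g1 ^+ 2 * r1 <= a2 * m * g2 ^+ 2 * r2.
    move=> a1_ge0 a12 g1_ge0 g12 r1_ge0 r12.
    have m_ge0 := ltW m0; have g2_ge0 := le_trans g1_ge0 g12.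
    apply: ler_pM => //; first by rewrite mulr_ge0 ?sqr_ge0 // mulr_ge0.
    apply: ler_pM; rewrite ?sqr_ge0 ?mulr_ge0 ?ler_wpM2r //.
    by rewrite lerXn2r.
  apply: step GE _ _.
  - by rewrite divr_ge0 ?mulr_ge0 // ltW.
  - rewrite ler_pM2l ?mulr_gt0 // lef_pV2 ?posrE // -natr1.
    by move: (j%:R) jle => z z_le; lra.
  - by rewrite divr_ge0 ?expR_ge0 // ltW.
  - by rewrite mulr_ge0 ?expR_ge0.
  - by rewrite ler_pM ?expR_ge0.
have cube := expR_ge_cube (ltW (mulr_gt0 delta0 L0)).
(* The exponents add up to [L + 2 * tau * L - alpha * L - beta * L = delta * L], and the constants
   to -4 - 1 - 1 = -6. *)
have expE : m * expR (tau * L - 2) ^+ 2 *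
    (expR (- (alpha * L) - 1) * expR (- (beta * L) - 1)) =
  expR (delta * L) / expR 6.
  rewrite mE expr2 -!expRD -expRN -expRD; congr expR; rewrite deltaE; ring.
have -> : beta * L / (2 * (tau * L)) * m *
    (expR (tau * L - 2) / (2 * (tau * L))) ^+ 2 *
    (expR (- (alpha * L) - 1) * expR (- (beta * L) - 1)) =
  beta / (8 * tau ^+ 3 * L ^+ 2) * (expR (delta * L) / expR 6).
  rewrite -expE; move: (expR (tau * L - 2)) (expR (- _ - 1)) (expR (- _ - 1)).
  by move=> y z w; field; rewrite !gt_eqF.
(* The cubic bound on [expR (delta * L)] leaves one power of [L] over the denominator [L ^+ 2], and
   216 = 8 * 27. *)
apply: (@le_trans _ _
  (beta / (8 * tau ^+ 3 * L ^+ 2) * ((delta * L / 3) ^+ 3 / expR 6))); last first.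
  rewrite ler_wpM2l ?ler_pM2r ?invr_gt0 ?expR_gt0 //.
  by rewrite ltW // divr_gt0 // !mulr_gt0 // exprn_gt0.
have e6 : 0 < expR 6 :> R by exact: expR_gt0.
have -> : beta / (8 * tau ^+ 3 * L ^+ 2) * ((delta * L / 3) ^+ 3 / expR 6) =
  L * (beta * delta ^+ 3) / (216 * tau ^+ 3 * expR 6).
  by field; rewrite !gt_eqF.
have den0 : 0 < 216 * tau ^+ 3 * expR 6 by rewrite !mulr_gt0 // exprn_gt0.
have num0 : 0 < beta * delta ^+ 3 by rewrite mulr_gt0 // exprn_gt0.
rewrite ler_pdivlMr // -ler_pdivrMr //.
rewrite (_ : 8 * (216 * _ * _) / _ = K0); first by lra.
by rewrite K0E; field; rewrite !gt_eqF.
Qed.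

End Asymptotics.

(* Contradiction with exact recovery *)
From mathcomp Require Import all_classical all_reals all_analysis.
Import numFieldNormedType.Exports.

Local Open Scope classical_set_scope.
Local Open Scope ring_scope.

Theorem theorem2 (R : realType) (alpha beta : R) (k : nat -> nat)
    (k_ge2 : forall m : nat, (2 <= k m)%N)
    (k_small : forall lambda : R, 0 < lambda ->
      (fun m : nat => (k m)%:R : R) =o_\oo (fun m : nat => m%:R `^ lambda))
    (beta_gt0 : 0 < beta) (beta_lt_alpha : beta < alpha)
    (gap : Num.sqrt alpha - Num.sqrt beta < 1) :
  ~ exists A : forall m : nat,
        {set {set 'I_(k m * m)}} -> {set {set 'I_(k m * m)}} -> R,
      (forall m : nat, is_procedure (A m)) /\
      ((fun m : nat =>
          recovery_prob (k m) m (alpha * ln m%:R / m%:R)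
            (beta * ln m%:R / m%:R) (A m)) @ \oo --> (1 : R)).
Proof.
case=> A [procA cvgA].
have [K bigK] := expected_number_ge8 beta_gt0 beta_lt_alpha gap.
have lt34 : 3 / 4 < 1 :> R by lra.
have [N _ recN] := cvgr_gt 1 cvgA (3 / 4) lt34.
(* The cluster size [n.+1] exceeds both [N], past which recovery has probability above 3/4, and
   [expR K], past which it has probability at most 3/4. *)
pose n := (N + Num.truncn (expR K))%N.
have Kn : K <= ln n.+1%:R.
  rewrite -[K]expRK ler_ln ?posrE ?expR_gt0 ?ltr0n //.
  apply: le_trans (ltW (truncnS_gt _)) _.
  by rewrite ler_nat ltnS leq_addl.
have [[n0 q0 qp p1 p98] [j jn a8]] := bigK n Kn.
have := recovery_prob_le34 q0 qp p1 (k_ge2 n.+1) n0 (procA n.+1) jn a8 p98.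
by rewrite leNgt recN //= /n; lia.
Qed.
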